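(* The strong negation ${\sim}$ is definable in $\mathrm{2Int}$ via the formula $$(A \wedge (A \rightarrow (A \prec A))) \vee ((A \rightarrow A) \prec A).$$ That is, writing ${\sim}A$ for this formula, the four rules ${\sim}I^+$, ${\sim}I^-$, ${\sim}E^+$, ${\sim}E^-$ are derivable in $\mathrm{2Int}$.
   Context: $\mathrm{2Int}$ is Wansing's bi-intuitionistic logic, a constructive logic with two forms of derivation: proofs (written with single inference lines) and dual proofs (written with double inference lines). Its language is $A ::= p \mid \top \mid \bot \mid A\wedge A \mid A\vee A \mid A\to A \mid A \prec A$, where $\prec$ denotes the co-implication. Assumptions may be discharged in proofs and counter-assumptions in dual proofs. The natural deduction rules of $\mathrm{2Int}$ are as follows (a ''proof of $X$'' means a derivation ending in $X$ with a single line, a ''dual proof of $X$'' one ending with a double line; in rules marked ''proof-or-dual'', all marked premises and the conclusion are uniformly proofs or uniformly dual proofs). Proof rules: $\wedge I^+$: from proofs of $A$ and $B$, a proof of $A\wedge B$; $\wedge E^+_{1,2}$: from a proof of $A\wedge B$, a proof of $A$ (resp. $B$). $\vee I^+_{1,2}$: from a proof of $A$ (resp. $B$), a proof of $A\vee B$; $\vee E^+$: from a proof of $A\vee B$, a derivation of $C$ from assumption $A$ and a derivation of $C$ from assumption $B$ (proof-or-dual), conclude $C$ (same kind), discharging the assumptions. $\to I^+$: from a proof of $B$ from assumption $A$, a proof of $A\to B$ (discharging $A$); $\to E^+$: from proofs of $A\to B$ and $A$, a proof of $B$. $\prec I^+$: from a proof of $A$ and a dual proof of $B$, a proof of $A\prec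 B$; $\prec E^+_1$: from a proof of $A\prec B$, a proof of $A$; $\prec E^+_2$: from a proof of $A\prec B$, a dual proof of $B$. $\top I^+$: a proof of $\top$; $\bot E^+$: from a proof of $\bot$, a proof or dual proof of any $A$. Dual-proof rules: $\wedge I^-_{1,2}$: from a dual proof of $A$ (resp. $B$), a dual proof of $A\wedge B$; $\wedge E^-$: from a dual proof of $A\wedge B$, a derivation of $C$ from counter-assumption $A$ and one of $C$ from counter-assumption $B$ (proof-or-dual), conclude $C$ (same kind), discharging. $\vee I^-$: from dual proofs of $A$ and $B$, a dual proof of $A\vee B$; $\vee E^-_{1,2}$: from a dual proof of $A\vee B$, a dual proof of $A$ (resp. $B$). $\to I^-$: from a proof of $A$ and a dual proof of $B$, a dual proof of $A\to B$; $\to E^-_1$: from a dual proof of $A\to B$, a proof of $A$; $\to E^-_2$: from a dual proof of $A\to B$, a dual proof of $B$. $\prec I^-$: from a dual proof of $A$ from counter-assumption $B$, a dual proof of $A\prec B$ (discharging $B$); $\prec E^-$: from dual proofs of $A\prec B$ and $B$, a dual proof of $A$. $\top E^-$: from a dual proof of $\top$, a proof or dual proof of any $A$; $\bot I^-$: a dual proof of $\bot$. Strong negation ${\sim}$ (from Nelson's logic N4) is governed in this bilateral setting by: ${\sim}I^+$: from a dual proof of $A$, a proof of ${\sim}A$; ${\sim}I^-$: from a proof of $A$, a dual proof of ${\sim}A$; ${\sim}E^+$: from a proof of ${\sim}A$, a dual proof of $A$; ${\sim}E^-$: from a dual proof of ${\sim}A$, a proof of $A$. *)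

(* Defs.v *)
From Stdlib Require Import List.
Import ListNotations.

Set Implicit Arguments.

(** Formulas over a set [V] of propositional variables;
    [Coimp A B] is the co-implication A ≺ B. *)
Inductive form (V : Type) : Type :=
| Var (p : V)
| Top
| Bot
| And (A B : form V)
| Or (A B : form V)
| Imp (A B : form V)
| Coimp (A B : form V).

Arguments Top {V}.
Arguments Bot {V}.

Declare Scope form_scope.
Delimit Scope form_scope with form.
Bind Scope form_scope with form.

Notation "⊤" := Top : form_scope.
Notation "⊥" := Bot : form_scope.
Notation "A ∧ B" := (And A B) (at level 80, right associativity) : form_scope.
Notation "A ∨ B" := (Or A B) (at level 85, right associativity) : form_scope.
Notation "A ⇒ B" := (Imp A B) (at level 86, right associativity) : form_scope.
Notation "A ≺ B" := (Coimp A B) (at level 86, no associativity) : form_scope.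

(** [pos] marks proofs (single line) and assumptions, [neg] marks dual proofs
    (double line) and counter-assumptions. *)
Inductive sign : Type := pos | neg.

Definition judgment (V : Type) : Type := (sign * form V)%type.

Notation "'+:' A" := (pos, A%form) (at level 90).
Notation "'-:' A" := (neg, A%form) (at level 90).

Reserved Notation "G ⊢ J" (at level 95, no associativity).

(** [G ⊢ (s, C)]: there is a natural deduction derivation of kind [s] with
    conclusion [C] all of whose open (counter-)assumptions are in [G].  A rule
    that discharges a leaf has it added to [G] in the corresponding premise;
    [G] is used only through membership, so vacuous and multiple discharge are
    allowed.  The "proof-or-dual" rules are those with a variable sign [s]. *)
Inductive derives (V : Type) (G : list (judgment V)) : judgment V -> Prop :=
| hyp s A : In (s, A) G -> G ⊢ (s, A)
| AndI_pos A B : G ⊢ +: A -> G ⊢ +: B -> G ⊢ +: (A ∧ B)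
| AndE1_pos A B : G ⊢ +: (A ∧ B) -> G ⊢ +: A
| AndE2_pos A B : G ⊢ +: (A ∧ B) -> G ⊢ +: B
| OrI1_pos A B : G ⊢ +: A -> G ⊢ +: (A ∨ B)
| OrI2_pos A B : G ⊢ +: B -> G ⊢ +: (A ∨ B)
| OrE_pos s A B C :
    G ⊢ +: (A ∨ B) -> (+: A) :: G ⊢ (s, C) -> (+: B) :: G ⊢ (s, C) -> G ⊢ (s, C)
| ImpI_pos A B : (+: A) :: G ⊢ +: B -> G ⊢ +: (A ⇒ B)
| ImpE_pos A B : G ⊢ +: (A ⇒ B) -> G ⊢ +: A -> G ⊢ +: B
| CoimpI_pos A B : G ⊢ +: A -> G ⊢ -: B -> G ⊢ +: (A ≺ B)
| CoimpE1_pos A B : G ⊢ +: (A ≺ B) -> G ⊢ +: A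
| CoimpE2_pos A B : G ⊢ +: (A ≺ B) -> G ⊢ -: B
| TopI_pos : G ⊢ +: ⊤
| BotE_pos s A : G ⊢ +: ⊥ -> G ⊢ (s, A)
| AndI1_neg A B : G ⊢ -: A -> G ⊢ -: (A ∧ B)
| AndI2_neg A B : G ⊢ -: B -> G ⊢ -: (A ∧ B)
| AndE_neg s A B C :
    G ⊢ -: (A ∧ B) -> (-: A) :: G ⊢ (s, C) -> (-: B) :: G ⊢ (s, C) -> G ⊢ (s, C)
| OrI_neg A B : G ⊢ -: A -> G ⊢ -: B -> G ⊢ -: (A ∨ B)
| OrE1_neg A B : G ⊢ -: (A ∨ B) -> G ⊢ -: A
| OrE2_neg A B : G ⊢ -: (A ∨ B) -> G ⊢ -: B
| ImpI_neg A B : G ⊢ +: A -> G ⊢ -: B -> G ⊢ -: (A ⇒ B)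
| ImpE1_neg A B : G ⊢ -: (A ⇒ B) -> G ⊢ +: A
| ImpE2_neg A B : G ⊢ -: (A ⇒ B) -> G ⊢ -: B
| CoimpI_neg A B : (-: B) :: G ⊢ -: A -> G ⊢ -: (A ≺ B)
| CoimpE_neg A B : G ⊢ -: (A ≺ B) -> G ⊢ -: B -> G ⊢ -: A
| TopE_neg s A : G ⊢ -: ⊤ -> G ⊢ (s, A)
| BotI_neg : G ⊢ -: ⊥
where "G ⊢ J" := (derives G J).

(** A (non-discharging) rule is derivable, as opposed to merely admissible, when
    its conclusion has a derivation whose open leaves are among its premises. *)
Definition derivable_rule (V : Type) (premises : list (judgment V))
    (conclusion : judgment V) : Prop :=
  premises ⊢ conclusion.

Definition sneg (V : Type) (A : form V) : form V :=
  ((A ∧ (A ⇒ (A ≺ A))) ∨ ((A ⇒ A) ≺ A))%form.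

Lemma derives_subst (V : Type) (G H : list (judgment V)) (J : judgment V) :
  G ⊢ J -> (forall K, In K G -> H ⊢ K) -> H ⊢ J.
Proof.
  assert (weak : forall G J, G ⊢ J -> forall H : list (judgment V),
            (forall K, In K G -> In K H) -> H ⊢ J).
  { clear; induction 1; intros H' HG;
      try (econstructor; eauto; fail).
    - eapply OrE_pos; [apply IHderives1 | apply IHderives2 | apply IHderives3];
        simpl; intuition.
    - apply ImpI_pos, IHderives; simpl; intuition.
    - eapply AndE_neg; [apply IHderives1 | apply IHderives2 | apply IHderives3];
        simpl; intuition.
    - apply CoimpI_neg, IHderives; simpl; intuition. }
  assert (ext : forall (G H : list (judgment V)) L,
            (forall K, In K G -> H ⊢ K) -> forall K, In K (L :: G) -> L :: H ⊢ K).
  { intros G0 H0 L HG [s A] [-> | HK].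
    - apply hyp; simpl; auto.
    - apply weak with H0; simpl; auto. }
  intros HJ; revert H; induction HJ; intros H' HG; auto;
    try (econstructor; eauto; fail).
Qed.

(** Derivations of the premises of a derivable rule, from any open
    (counter-)assumptions, extend to a derivation of its conclusion. *)
Lemma derivable_rule_sound (V : Type) (premises : list (judgment V))
    (conclusion : judgment V) (G : list (judgment V)) :
  derivable_rule premises conclusion ->
  (forall J, In J premises -> G ⊢ J) -> G ⊢ conclusion.
Proof. exact (@derives_subst V premises G conclusion). Qed.

(* Main.v *)
Require Import Defs.
From Stdlib Require Import List.
Import ListNotations.

(** As [A ⇒ A] is provable, a proof of [(A ⇒ A) ≺ A] amounts to a dual proof of [A]. Its dual proofs
    yield a proof of [A] only given a counter-assumption [A]; the left disjunct makes up for
    this. *)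

Theorem mainTheorem1 (V : Type) (A : form V) :
  derivable_rule [-: A] (+: sneg A) /\
  derivable_rule [+: A] (-: sneg A) /\
  derivable_rule [+: sneg A] (-: A) /\
  derivable_rule [-: sneg A] (+: A).
Proof.
  unfold derivable_rule, sneg; repeat split.
  - apply OrI2_pos, CoimpI_pos.
    + apply ImpI_pos, hyp; simpl; auto.
    + apply hyp; simpl; auto.
  - apply OrI_neg.
    + apply AndI2_neg, ImpI_neg; [| apply CoimpI_neg]; apply hyp; simpl; auto.
    + apply CoimpI_neg, ImpI_neg; apply hyp; simpl; auto.
  - eapply OrE_pos.
    + apply hyp; simpl; auto.
    + eapply CoimpE2_pos, ImpE_pos.
      * eapply AndE2_pos, hyp; simpl; auto.
      * eapply AndE1_pos, hyp; simpl; auto.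
    + eapply CoimpE2_pos, hyp; simpl; auto.
  (* Split the dually proved left disjunct: counter-assumption [A] turns the right one into a dual
     proof of [A ⇒ A]; a dual proof of [A ⇒ (A ≺ A)] already contains a proof of [A]. *)
  - eapply AndE_neg.
    + eapply OrE1_neg, hyp; simpl; auto.
    + eapply ImpE1_neg, CoimpE_neg.
      * eapply OrE2_neg, hyp; simpl; auto.
      * apply hyp; simpl; auto.
    + eapply ImpE1_neg, hyp; simpl; auto.
Qed.
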